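(* Let $\mathbf{x}\in\mathcal{X}_{pq}$ be a minimizer or a minimaximizer of the action $W_{pq}$. Then no stationary state $\mathbf{z}\in\mathcal{X}_{pq}$ with $\mathbf{z}\neq\mathbf{x}$ (i.e. no $\mathbf{z}\neq \mathbf{x}$ with $\nabla W_{pq}(\mathbf{z})=0$) belongs to the boundary of the cone $V_+(\mathbf{x})$ or to the boundary of the cone $V_-(\mathbf{x})$.
   Context: Let $f$ be an exact area-preserving positive twist $C^r$-diffeomorphism ($r\ge 1$) of the infinite annulus $\mathbb{A}=\mathbb{T}^1\times\mathbb{R}$, with lift $F:\mathbb{R}^2\to\mathbb{R}^2$. It has a $C^2$ generating function $h:\mathbb{R}^2\to\mathbb{R}$ with $h(x+1,x'+1)=h(x,x')$ and $h_{12}=\partial^2 h/\partial x\partial x'<0$ on $\mathbb{R}^2$, such that $F(x,y)=(x',y')$ iff $y=-h_1(x,x')$ and $y'=h_2(x,x')$, where $h_1=\partial h/\partial x$, $h_2=\partial h/\partial x'$. The second derivatives of $h$ are assumed bounded. Let $p,q$ be coprime integers, $q>0$. $\mathcal{X}_{pq}$ is the space of $(p,q)$-configurations, i.e. real sequences $\mathbf{x}=(x_n)_{n\in\mathbb{Z}}$ with $x_{n+q}=x_n+p$ for all $n$; it is identified with $\mathbb{R}^q$ via $(x_0,\dots,x_{q-1})$, and interiors and boundaries are taken in this topology. The action is $W_{pq}(\mathbf{x})=\sum_{k=0}^{q-1}h(x_k,x_{k+1})$. Order: $\mathbf{x}\le\mathbf{y}$ iff $x_k\le y_k$ for all $k$.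 Order cones: $V_+(\mathbf{x})=\{\mathbf{y}\in\mathcal{X}_{pq}:\mathbf{x}\le\mathbf{y}\}$ and $V_-(\mathbf{x})=\{\mathbf{z}\in\mathcal{X}_{pq}:\mathbf{z}\le\mathbf{x}\}$. Write $\mathbf{x}\prec\mathbf{y}$ if $x_k<y_k$ for all $k$. A $(p,q)$-minimizer is a global minimizer of $W_{pq}$ on $\mathcal{X}_{pq}$; $M_{pq}$ is the set of all of them. Two minimizers $\mathbf{a}\prec\mathbf{a}'$ are consecutive if there is no $\mathbf{a}''\in M_{pq}$ with $\mathbf{a}\prec\mathbf{a}''\prec\mathbf{a}'$. A $(p,q)$-minimaximizer is a critical point $\mathbf{y}$ of $W_{pq}$ of minimax type in the sense of Aubry--Mather theory: for some consecutive minimizers $\mathbf{a}\prec\mathbf{a}'$ one has $\mathbf{a}\prec\mathbf{y}\prec\mathbf{a}'$ and $W_{pq}(\mathbf{y})=\inf_\gamma\max_{t\in[0,1]}W_{pq}(\gamma(t))$, the infimum being over continuous paths $\gamma:[0,1]\to\{\mathbf{z}\in\mathcal{X}_{pq}:\mathbf{a}\le\mathbf{z}\le\mathbf{a}'\}$ with $\gamma(0)=\mathbf{a}$, $\gamma(1)=\mathbf{a}'$. *)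

(* Defs.v *)
From HB Require Import structures.
From mathcomp Require Export all_boot all_order all_algebra.
From mathcomp Require Export all_classical all_reals all_analysis.
Export Order.TTheory GRing.Theory Num.Theory.
Export numFieldNormedType.Exports.

Set Implicit Arguments.
Unset Strict Implicit.
Unset Printing Implicit Defensive.

Global Open Scope classical_set_scope.
Global Open Scope ring_scope.

Definition boundary (T : topologicalType) (A : set T) : set T :=
  closure A `\` interior A.

Section plane.
Variable R : realType.
Implicit Types (g S h : R * R -> R) (F G : R * R -> R * R) (w : R * R).

Definition pd1 g : R * R -> R := fun w => 'D_((1, 0) : R * R) g w.
Definition pd2 g : R * R -> R := fun w => 'D_((0, 1) : R * R) g w.

Fixpoint classC (r : nat) g : Prop :=
  if r is r'.+1 then
    [/\ forall w, differentiable g w, classC r' (pd1 g) & classC r' (pd2 g)]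
  else continuous g.

Definition classC_map (r : nat) F : Prop :=
  classC r (fst \o F) /\ classC r (snd \o F).

Definition diffeo (r : nat) F : Prop :=
  exists G, [/\ cancel F G, cancel G F, classC_map r F & classC_map r G].

(* [F] commutes with the deck transformation (x, y) |-> (x + 1, y) of the
   covering R^2 -> T^1 x R, so it is the lift of a map of the annulus which is
   homotopic to the identity. *)
Definition annulus_lift F : Prop :=
  forall x y, F (x + 1, y) = ((F (x, y)).1 + 1, (F (x, y)).2).

(* dx' /\ dy' = dx /\ dy *)
Definition area_preserving F : Prop :=
  forall w, pd1 (fst \o F) w * pd2 (snd \o F) w
            - pd2 (fst \o F) w * pd1 (snd \o F) w = 1.

(* y' dx' - y dx = dS for some function S on the annulus *)
Definition exact_map F : Prop :=
  exists S, [/\ forall x y, S (x + 1, y) = S (x, y),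
    forall w, differentiable S w,
    forall w, pd1 S w = (F w).2 * pd1 (fst \o F) w - w.2 &
    forall w, pd2 S w = (F w).2 * pd2 (fst \o F) w].

Definition positive_twist F : Prop := forall w, 0 < pd2 (fst \o F) w.

Record twist_diffeo (r : nat) F : Prop := TwistDiffeo {
  twist_diffeo_lift : annulus_lift F;
  twist_diffeo_diffeo : diffeo r F;
  twist_diffeo_exact : exact_map F;
  twist_diffeo_area : area_preserving F;
  twist_diffeo_twist : positive_twist F }.

Record generating_function F h : Prop := GeneratingFunction {
  genf_C2 : classC 2 h;
  genf_periodic : forall x x', h (x + 1, x' + 1) = h (x, x');
  genf_h12_lt0 : forall w, pd1 (pd2 h) w < 0;
  genfP : forall x y x' y',
    F (x, y) = (x', y') <-> y = - pd1 h (x, x') /\ y' = pd2 h (x, x') }.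

Definition bounded_second_derivatives h : Prop :=
  exists M : R, forall w,
    [/\ `|pd1 (pd1 h) w| <= M, `|pd1 (pd2 h) w| <= M,
        `|pd2 (pd1 h) w| <= M & `|pd2 (pd2 h) w| <= M].

End plane.

Section configurations.
Variables (R : realType) (h : R * R -> R) (p : int) (q : nat).
Implicit Types (x y z a b : int -> R) (v : 'rV[R]_q) (A : set (int -> R)).

Definition config : set (int -> R) :=
  [set x | forall n : int, x (n + q%:Z) = x n + p%:~R].

(* [coord] and [of_coord] are the mutually inverse identifications of [config]
   with R^q. *)
Definition coord x : 'rV[R]_q := \row_(k < q) x (k : nat)%:Z.

(* x_n = x_(n mod q) + p * (n div q); [insub] turns the residue into an element
   of 'I_q, and the default value is only used when q = 0. *)
Definition of_coord v : int -> R := fun n =>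
  oapp (v 0) 0 (insub `|(n %% q%:Z)%Z|%N) + (p * (n %/ q%:Z)%Z)%:~R.

Lemma coord_of_coord v : coord (of_coord v) = v.
Proof.
apply/rowP => k; rewrite mxE /of_coord modz_small ?divz_small ?ltz_nat //=;
  try by rewrite le0z_nat ltz_nat ltn_ord.
by rewrite mulr0 addr0 valK.
Qed.

Lemma of_coord_config v : (0 < q)%N -> config (of_coord v).
Proof.
move=> q0 n; rewrite /of_coord modzDr divzDr ?dvdzz // divzz.
by rewrite eqz_nat -lt0n q0 mulrDr mulr1 intrD addrA.
Qed.

Lemma config_mul x : config x ->
  forall n m : int, x (n + m * q%:Z) = x n + (p * m)%:~R.
Proof.
move=> cx n; elim/int_ind => [|m IH|m IH].
- by rewrite mul0r mulr0 !addr0.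
- by rewrite -addn1 PoszD mulrDl mul1r addrA cx IH mulrDr mulr1 intrD addrA.
- rewrite -addn1 PoszD; apply: (addIr p%:~R); rewrite -cx -[RHS]addrA -intrD.
  have -> : n + - (m%:Z + 1) * q%:Z + q%:Z = n + - m%:Z * q%:Z.
    by rewrite opprD mulrDl mulN1r -!addrA addNr addr0.
  by rewrite IH; congr (_ + _%:~R); rewrite opprD mulrDr mulrN1 -addrA addNr addr0.
Qed.

Lemma of_coord_coord x : (0 < q)%N -> config x -> of_coord (coord x) = x.
Proof.
move=> q0 cx; apply/funext => n; rewrite /of_coord.
have qn0 : q%:Z != 0 by rewrite eqz_nat -lt0n.
have m0 := modz_ge0 n qn0.
have ltm : (`|(n %% q%:Z)%Z|%N < q)%N by rewrite -ltz_nat gez0_abs // ltz_pmod.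
rewrite insubT /= mxE /= gez0_abs // -(config_mul cx) addrC.
by rewrite -divz_eq.
Qed.

Definition config_boundary A : set (int -> R) :=
  [set z | config z /\ boundary (coord @` A) (coord z)].

Definition action x : R := \sum_(k < q) h (x (k : nat)%:Z, x (k : nat).+1%:Z).

Definition grad_action x : 'rV[R]_q :=
  \row_(k < q) 'D_(delta_mx 0 k) (action \o of_coord) (coord x).

Definition stationary x : Prop := config x /\ grad_action x = 0.

Definition config_le x y : Prop := forall k : int, x k <= y k.
Definition config_lt x y : Prop := forall k : int, x k < y k.

Definition cone_plus x : set (int -> R) := [set y | config y /\ config_le x y].
Definition cone_minus x : set (int -> R) := [set z | config z /\ config_le z x].

Definition minimizers : set (int -> R) :=
  [set x | config x /\ forall y, config y -> action x <= action y].

Definition consecutive a b : Prop :=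
  [/\ minimizers a, minimizers b, config_lt a b &
      ~ exists c, [/\ minimizers c, config_lt a c & config_lt c b]].

Definition config_path a b (gamma : R -> int -> R) : Prop :=
  [/\ {within `[0, 1], continuous (coord \o gamma)},
      gamma 0 = a, gamma 1 = b &
      forall t : R, 0 <= t <= 1 ->
        [/\ config (gamma t), config_le a (gamma t) & config_le (gamma t) b]].

(* the numbers max_{t in [0, 1]} W(gamma t), for gamma a path from a to b *)
Definition path_maxima a b : set R :=
  [set m | exists2 gamma, config_path a b gamma &
     let I := [set action (gamma t) | t in `[0, 1]] in I m /\ ubound I m].

Definition minimaximizer y : Prop :=
  stationary y /\
  exists a b, [/\ consecutive a b, config_lt a y, config_lt y b &
                  action y = inf (path_maxima a b)].

End configurations.

(* Main.v *)
(* Minimizers and minimaximizers are both stationary, so it suffices to show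
   that distinct ordered stationary states x <= z nowhere touch. Stationarity
   reads h_1(x_n, x_{n+1}) + h_2(x_{n-1}, x_n) = 0 for all n; if x_n = z_n, then
   both terms can only decrease from x to z, because h_1 is decreasing in its
   second argument and h_2 in its first. As both sums vanish, x and z agree at
   n - 1 and n + 1 too, hence everywhere. *)
From mathcomp Require Import lra.
Require Import Defs.

Set Implicit Arguments.
Unset Strict Implicit.
Unset Printing Implicit Defensive.

(** * Directional derivatives as derivatives along lines *)

Lemma quotient_line (R : numFieldType) (V W : normedModType R) (f : V -> W)
    (w v : V) (s : R) :
  (fun t : R => t^-1 *: (((fun r : R => f (w + r *: v)) \o shift s)
                           (t *: (1 : R)) - f (w + s *: v))) =
  (fun t : R => t^-1 *: ((f \o shift (w + s *: v)) (t *: v)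
                         - f (w + s *: v))).
Proof.
apply/funext => t /=.
by rewrite [t *: (1 : R)]mulr1 scalerDl addrCA.
Qed.

(** Both difference quotients are the same function of the increment. One-variable calculus
    (monotonicity from the sign of the derivative, vanishing at a minimum) thus becomes available
    for directional derivatives. *)
Lemma is_derive_line (R : numFieldType) (V W : normedModType R) (f : V -> W)
    (w v : V) (s : R) (df : W) :
  is_derive (w + s *: v) v f df <->
  is_derive s 1 (fun t : R => f (w + t *: v)) df.
Proof.
split=> -[D E]; apply: DeriveDef.
- by move: D; rewrite /derivable quotient_line.
- by move: E; rewrite /derive quotient_line.
- by move: D; rewrite /derivable quotient_line.
- by move: E; rewrite /derive quotient_line.
Qed.

Lemma increasing_line (R : realType) (V : normedModType R) (f : V -> R)
    (w v : V) :
  (forall u, differentiable f u) -> (forall u, 0 < 'D_v f u) ->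
  {homo (fun t : R => f (w + t *: v)) : s t / s < t}.
Proof.
move=> df f_gt0 s t st.
have D (r : R) :
    is_derive r 1 (fun t : R => f (w + t *: v)) ('D_v f (w + r *: v)).
  by apply/is_derive_line/derivableP/diff_derivable.
have dline (r : R) : derivable (fun t : R => f (w + t *: v)) r 1 by case: (D r).
apply: (@gtr0_derive1_lt_cc R (fun r => f (w + r *: v)) s t) => //.
- by move=> r _; rewrite derive1E; case: (D r) => _ ->.
- apply: (@continuous_subspaceT _ _ _ (fun t : R => f (w + t *: v))) => r.
  exact/differentiable_continuous/derivable1_diffP/dline.
- by rewrite in_itv /= lexx ltW.
- by rewrite in_itv /= lexx ltW.
Qed.

Lemma derive_pair (R : realType) (g : R * R -> R) (w : R * R) (c d : R) :
  differentiable g w -> 'D_((c, d) : R * R) g w = c * pd1 g w + d * pd2 g w.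
Proof.
move=> dg; rewrite /pd1 /pd2 !deriveE //.
have -> : (c, d) = c *: ((1, 0) : R * R) + d *: ((0, 1) : R * R).
  rewrite [RHS]surjective_pairing /=.
  by rewrite [c *: _]mulr1 [c *: _]mulr0 [d *: _]mulr0 [d *: _]mulr1 addr0 add0r.
by rewrite linearD !linearZ.
Qed.

(** The set is closed, and if every [f i v] were positive, continuity and the finiteness of [I]
    would give a neighbourhood of [v] inside it. *)
Lemma boundary_forall_ge0 (R : realType) (T : topologicalType) (I : finType)
    (f : I -> T -> R) (v : T) :
  (forall i, continuous (f i)) ->
  boundary [set u | forall i, 0 <= f i u] v ->
  (forall i, 0 <= f i v) /\ exists i, f i v = 0.
Proof.
move=> cf [clv nintv]; have ge0 i : 0 <= f i v.
  rewrite leNgt; apply/negP => lt0.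
  have [u [ule0 /= ult0]] := clv _ (cf i v _ (lt_nbhsl lt0)).
  by have := ule0 i; rewrite leNgt ult0.
split=> //; apply: contrapT => /forallNP neq0; apply: nintv.
suff nb i : \forall u \near v, 0 <= f i u by exact: filter_forall nb.
have gt0 : 0 < f i v by rewrite lt_neqAle eq_sym ge0 andbT; apply/eqP/neq0.
have /= : \forall u \near v, 0 < f i u by exact: (cf i v _ (lt_nbhsr gt0)).
by apply: filterS => u /ltW.
Qed.

Lemma modz_ord (q : nat) (n : int) :
  (0 < q)%N -> exists k : 'I_q, (n %% q%:Z)%Z = k.
Proof.
move=> q0; have qn0 : q%:Z != 0 by rewrite eqz_nat -lt0n.
have m0 := modz_ge0 n qn0.
have ltm : (`|(n %% q%:Z)%Z|%N < q)%N by rewrite -ltz_nat gez0_abs // ltz_pmod.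
by exists (Ordinal ltm); rewrite /= gez0_abs.
Qed.

(** * The gradient of the action *)

Section stationary_states.
Variables (R : realType) (h : R * R -> R) (p : int) (q : nat).
Implicit Types (x z : int -> R) (v : 'rV[R]_q).

(** Varying one coordinate of R^q moves every entry whose index is congruent to [k] modulo [q]. *)
Lemma of_coord_add_delta v (k : 'I_q) (t : R) (n : int) :
  of_coord p (v + t *: delta_mx 0 k) n =
  of_coord p v n + t * ((n %% q%:Z)%Z == k)%:R.
Proof.
have q0 : (0 < q)%N by case: q k => // -[].
have [k' E] := modz_ord n q0.
by rewrite /of_coord E absz_nat valK /= !mxE /= addrAC eqz_nat.
Qed.

(** The discrete Euler-Lagrange expression. It is indexed by all integers so that the touching
    argument can cross the ends of a period. *)
Definition force x (n : int) : R :=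
  pd1 h (x n, x (n + 1)) + pd2 h (x (n - 1), x n).

Hypothesis h_periodic : forall a b, h (a + 1, b + 1) = h (a, b).

Lemma h_periodicz (m : int) a b : h (a + m%:~R, b + m%:~R) = h (a, b).
Proof.
elim/int_ind: m a b => [|m IH|m IH] a b; first by rewrite !addr0.
- by rewrite -addn1 PoszD intrD !addrA h_periodic IH.
- rewrite -addn1 PoszD opprD intrD !addrA -h_periodic.
  by rewrite -!addrA addNr !addr0 IH.
Qed.

Lemma derive_periodicz (d : R * R) (m : int) a b :
  'D_d h (a + m%:~R, b + m%:~R) = 'D_d h (a, b).
Proof.
rewrite /derive h_periodicz.
rewrite (_ : h \o shift (a + m%:~R, b + m%:~R) = h \o shift (a, b)) //.
apply/funext => -[c e] /=.
by rewrite -(h_periodicz m (c + a)) -!addrA.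
Qed.

(** Shifting the index by [m * q] translates both arguments of [h] by the integer [p * m]. *)
Lemma force_periodic x (n m : int) :
  config p q x -> force x (n + m * q%:Z) = force x n.
Proof.
move=> cx; rewrite /force /pd1 /pd2 addrAC [n + _ - 1]addrAC.
by rewrite !(config_mul cx) !derive_periodicz.
Qed.

Hypothesis h_diff : forall w, differentiable h w.

Lemma is_derive_action v (k : 'I_q) :
  is_derive v (delta_mx 0 k) (action h q \o @of_coord R p q)
    (force (of_coord p v) (k : nat)%:Z).
Proof.
have q0 : (0 < q)%N by case: q k => // -[].
have cx := of_coord_config p v q0; set x := of_coord p v in cx *.
(* [v] is the point of parameter 0 on the line in direction [delta_mx 0 k]. *)
rewrite -[v]addr0 -(scale0r (delta_mx 0 k)); apply/is_derive_line.
(* [u] is the [q]-periodic variation induced by that direction; for [q = 1] it moves both arguments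
   of [h] at once. *)
pose u (n : int) : R := ((n %% q%:Z)%Z == k)%:R.
pose w (j : nat) := (x j%:Z, x j.+1%:Z).
pose d (j : nat) : R * R := (u j%:Z, u j.+1%:Z).
rewrite [X in is_derive _ _ X](_ : _ =
    \sum_(j < q) (fun t : R => h (w j + t *: d j))); last first.
  apply/funext => t; rewrite fct_sumE; apply: eq_bigr => j _.
  by rewrite /= !of_coord_add_delta.
rewrite (_ : force _ _ = \sum_(j < q) 'D_(d j) h (w j + 0 *: d j)).
  apply: is_derive_sum => j.
  by apply/is_derive_line/derivableP/diff_derivable.
under eq_bigr do rewrite scale0r addr0 derive_pair //.
pose G (j : nat) : R := u j%:Z * pd2 h (x (j%:Z - 1), x j%:Z).
have Gq : G q = G 0%N.
  rewrite /G /u modzz mod0z -[q%:Z]add0r addrAC !cx /pd2.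
  by rewrite derive_periodicz.
(* Summation by parts; the boundary terms [G q] and [G 0] cancel. *)
rewrite (eq_bigr (fun j : 'I_q =>
    u (j : nat)%:Z * force x (j : nat)%:Z + (G j.+1 - G j))); last first.
  move=> j _; rewrite /G /force /w -addn1 PoszD addrK mulrDr -addrA.
  by rewrite [u j * pd2 h _ + _]addrC subrK.
rewrite big_split /=.
rewrite -(big_mkord xpredT (fun j => G j.+1 - G j)) telescope_sumr // Gq.
rewrite subrr addr0 (bigD1 k) //= big1 ?addr0 => [|j jk].
  by rewrite /u modz_small ?eqxx ?mul1r // le0z_nat ltz_nat ltn_ord.
rewrite /u modz_small ?le0z_nat ?ltz_nat ?ltn_ord //.
by rewrite eqz_nat val_eqE (negbTE jk) mul0r.
Qed.

Lemma grad_actionE x : config p q x ->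
  grad_action h p q x = \row_k force x (k : nat)%:Z.
Proof.
move=> cx; apply/rowP => k; rewrite !mxE.
have q0 : (0 < q)%N by case: q k => // -[].
by case: (is_derive_action (coord q x) k) => _ ->; rewrite of_coord_coord.
Qed.

Lemma stationary_force x : (0 < q)%N -> stationary h p q x ->
  forall n, force x n = 0.
Proof.
move=> q0 [cx]; rewrite grad_actionE // => /rowP grad0 n.
have [k E] := modz_ord n q0.
rewrite (divz_eq n q%:Z) addrC force_periodic // E.
by have := grad0 k; rewrite !mxE.
Qed.

(** The action restricted to each coordinate line through [coord q x] is minimal at parameter 0, so
    its derivative vanishes there. *)
Lemma minimizer_stationary x :
  minimizers h p q x -> stationary h p q x.
Proof.
move=> [cx xmin]; split=> //; apply/rowP => k; rewrite !mxE.
have q0 : (0 < q)%N by case: q k => // -[].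
pose phi (t : R) :=
  (action h q \o @of_coord R p q) (coord q x + t *: delta_mx 0 k).
have phi_min t : phi 0 <= phi t.
  rewrite /phi scale0r addr0 /= of_coord_coord //.
  exact/xmin/of_coord_config.
have phi_derivable t : derivable phi t 1.
  case: (is_derive_action (coord q x + t *: delta_mx 0 k) k) => D _.
  by have [] := (is_derive_line _ _ _ _ _).1 (derivableP D).
have phi0 : is_derive (0 : R) 1 phi 0.
  apply: (@derive1_at_min R phi (-1) 1) => //.
  by rewrite in_itv /= ltrN10 ltr01.
have [_] := (is_derive_line _ _ _ _ _).2 phi0.
by rewrite scale0r addr0.
Qed.

(** * Stationary states that touch *)

Hypothesis h1_decr : forall a, {homo (fun b => pd1 h (a, b)) : b c /~ b < c}.
Hypothesis h2_decr : forall b, {homo (fun a => pd2 h (a, b)) : a c /~ a < c}.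

Lemma touching_neighbours x z (n : int) : force x n = 0 -> force z n = 0 ->
  config_le x z -> x n = z n -> x (n + 1) = z (n + 1) /\ x (n - 1) = z (n - 1).
Proof.
rewrite /force => + + xz xzn; rewrite -xzn.
move: (xz (n + 1)) (xz (n - 1)); rewrite !le_eqVlt.
(* A strict inequality at either neighbour makes the force of [z] at [n] smaller than that of [x],
   although both are zero. *)
case/predU1P => [->|/(h1_decr (x n)) lt1];
  case/predU1P => [->|/(h2_decr (x n)) lt2] //; lra.
Qed.

Lemma touching_eq x z (n : int) : (0 < q)%N ->
  stationary h p q x -> stationary h p q z ->
  config_le x z -> x n = z n -> x = z.
Proof.
move=> q0 sx sz xz xzn; apply/funext => m; rewrite -(subrK n m) addrC.
have F := stationary_force q0.
have T k := touching_neighbours (F _ sx k) (F _ sz k) xz.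
(* Equality spreads from [n] in both directions. *)
elim/int_ind: (m - n) => [|k IH|k IH]; first by rewrite addr0.
- by rewrite -addn1 PoszD addrA; case: (T _ IH).
- by rewrite -addn1 PoszD opprD addrA; case: (T _ IH).
Qed.

(** * Boundaries of the order cones *)

Lemma config_le_coord x z : (0 < q)%N -> config p q x -> config p q z ->
  config_le x z <-> forall k, coord q x 0 k <= coord q z 0 k.
Proof.
move=> q0 cx cz; split=> [xz k|xz n]; first by rewrite !mxE.
have [k E] := modz_ord n q0.
rewrite -(of_coord_coord q0 cx) -(of_coord_coord q0 cz) /of_coord E absz_nat.
by rewrite valK lerD2r /= xz.
Qed.

(** Common to both cones: under the identification with R^q, [A] is cut out by finitely many
    continuous inequalities, one of which is an equality at a boundary point. *)
Lemma config_boundary_ge0 (A : set (int -> R)) (f : 'I_q -> 'rV[R]_q -> R) z :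
  (0 < q)%N -> A `<=` config p q ->
  (forall y, config p q y -> A y <-> forall k, 0 <= f k (coord q y)) ->
  (forall k, continuous (f k)) ->
  config_boundary p q A z -> A z /\ exists k, f k (coord q z) = 0.
Proof.
move=> q0 Ac Af cf [cz].
have -> : @coord R q @` A = [set u | forall k, 0 <= f k u].
  apply/seteqP; split=> [_ [y Ay <-]|u fu]; first exact: (Af y (Ac y Ay)).1.
  exists (of_coord p u); last exact: coord_of_coord.
  by apply/(Af _ (of_coord_config p u q0)); rewrite coord_of_coord.
by case/(boundary_forall_ge0 cf) => /(Af z cz).2.
Qed.

Lemma cone_plus_boundary x z : (0 < q)%N -> config p q x ->
  config_boundary p q (cone_plus p q x) z ->
  config_le x z /\ exists n, x n = z n.
Proof.
move=> q0 cx.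
case/(@config_boundary_ge0 _ (fun k u => u 0 k - coord q x 0 k)) => //.
- by move=> y [].
- move=> y cy; split=> [[_ xy] k|xy].
    by rewrite subr_ge0; exact: (config_le_coord q0 cx cy).1.
  by split=> //; apply/(config_le_coord q0 cx cy) => k; rewrite -subr_ge0.
- move=> k u.
  by apply: (@continuousB R R); [exact: coord_continuous|exact: cst_continuous].
- move=> [_ xz] [k /eqP]; rewrite subr_eq0 !mxE => /eqP E.
  by split=> //; exists (k : nat)%:Z.
Qed.

Lemma cone_minus_boundary x z : (0 < q)%N -> config p q x ->
  config_boundary p q (cone_minus p q x) z ->
  config_le z x /\ exists n, z n = x n.
Proof.
move=> q0 cx.
case/(@config_boundary_ge0 _ (fun k u => coord q x 0 k - u 0 k)) => //.
- by move=> y [].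
- move=> y cy; split=> [[_ xy] k|xy].
    by rewrite subr_ge0; exact: (config_le_coord q0 cy cx).1.
  by split=> //; apply/(config_le_coord q0 cy cx) => k; rewrite -subr_ge0.
- move=> k u.
  by apply: (@continuousB R R); [exact: cst_continuous|exact: coord_continuous].
- move=> [_ xz] [k /eqP]; rewrite subr_eq0 !mxE => /eqP E.
  by split=> //; exists (k : nat)%:Z.
Qed.

End stationary_states.

(* The twist makes [y |-> x'] increasing at fixed [x], and [y = - h1 (x, x')]
   inverts that map; this avoids the symmetry of the mixed derivatives of [h]. *)
Lemma generating_pd1_decr (R : realType) (r : nat) (F : R * R -> R * R)
    (h : R * R -> R) (a : R) :
  (1 <= r)%N -> twist_diffeo r F -> generating_function F h ->
  {homo (fun b => pd1 h (a, b)) : b c /~ b < c}.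
Proof.
move=> r1 [_ [G [_ _ [CF _] _]] _ _ twist] [_ _ _ FP] b c bc.
have dF w : differentiable (fst \o F) w by case: r r1 CF => // r _ [].
have FE b' : (F (a, - pd1 h (a, b'))).1 = b'.
  by have /FP -> : - pd1 h (a, b') = - pd1 h (a, b') /\
                 pd2 h (a, b') = pd2 h (a, b') by [].
have incr := increasing_line (a, 0) dF twist.
(* Equal values of [pd1 h] would force [b = c]; values in the wrong order would, by the twist,
   reverse the order of [b] and [c]. *)
rewrite ltNge le_eqVlt; apply/negP => /predU1P[E|L].
  by move: bc; rewrite -(FE b) -(FE c) E ltxx.
have line t : (a, 0) + t *: (0, 1) = (a, t) :> R * R.
  by rewrite [LHS]surjective_pairing /= [t *: _]mulr0 [t *: _]mulr1 addr0 add0r.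
have := incr (- pd1 h (a, b)) (- pd1 h (a, c)); rewrite !line /= !FE ltrN2.
by move=> /(_ L); rewrite ltNge ltW.
Qed.

(** Here the sign of [pd1 (pd2 h)] applies directly; the direction (-1, 0) turns the decrease into
    the increase that [increasing_line] provides. *)
Lemma generating_pd2_decr (R : realType) (F : R * R -> R * R)
    (h : R * R -> R) (b : R) :
  generating_function F h -> {homo (fun a => pd2 h (a, b)) : a c /~ a < c}.
Proof.
move=> [[_ _ [dh2 _ _]] _ h12 _] a c ac.
have line t : (0, b) + t *: (-1, 0) = (- t, b) :> R * R.
  by rewrite [LHS]surjective_pairing /= [t *: _]mulrN1 [t *: _]mulr0 addr0 add0r.
have incr := @increasing_line R _ (pd2 h) (0, b) (-1, 0) dh2.
have := incr _ (- a) (- c); rewrite !line !opprK ltrN2; apply=> // w.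
by rewrite derive_pair // mul0r addr0 mulN1r oppr_gt0.
Qed.

Theorem proposition2p1 (R : realType) (r : nat) (r_ge1 : (1 <= r)%N)
    (F : R * R -> R * R) (h : R * R -> R)
    (F_twist : twist_diffeo r F) (F_h : generating_function F h)
    (h_bounded : bounded_second_derivatives h)
    (p : int) (q : nat) (q_gt0 : (0 < q)%N) (pq_coprime : coprimez p q%:Z)
    (x : int -> R) (x_config : config p q x)
    (x_min : minimizers h p q x \/ minimaximizer h p q x) :
  forall z : int -> R, stationary h p q z -> z <> x ->
    ~ config_boundary p q (cone_plus p q x) z /\
    ~ config_boundary p q (cone_minus p q x) z.
Proof.
move=> z sz zx.
have h_per := genf_periodic F_h.
have [dh _ _] := genf_C2 F_h.
have sx : stationary h p q x.
  (* For a minimaximizer, stationarity is part of the definition. *)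
  by case: x_min => [/(minimizer_stationary h_per dh)|[]].
have touch := touching_eq h_per dh
  (fun a => @generating_pd1_decr R r F h a r_ge1 F_twist F_h)
  (fun b => @generating_pd2_decr R F h b F_h) q_gt0.
split=> [/(cone_plus_boundary q_gt0 x_config)|
         /(cone_minus_boundary q_gt0 x_config)] [le [n eqn]]; apply: zx.
- by rewrite (touch _ _ _ _ sx sz le eqn).
- exact: touch _ _ _ _ sz sx le eqn.
Qed.
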